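(* Let $c(n)$ (resp. $d(n)$) be the number of permutations of $[n]$, $n\ge1$, in which every alternating run has length less than $3$ and the last alternating run has length $1$ (resp. $2$); set $c(0)=d(0)=0$. Then, with $Q(x)=\sum_{n\ge0}\bigl(E_{3n}\frac{x^{3n}}{(3n)!}-E_{3n+1}\frac{x^{3n+1}}{(3n+1)!}\bigr)$, \[ \sum_{n\ge0}c(n)\frac{x^n}{n!}=\frac{\sum_{n\ge0}\bigl(E_{3n+1}\frac{x^{3n+1}}{(3n+1)!}-E_{3n+2}\frac{x^{3n+2}}{(3n+2)!}\bigr)}{Q(x)},\qquad \sum_{n\ge0}d(n)\frac{x^n}{n!}=\frac{\sum_{n\ge0}\bigl(E_{3n+2}\frac{x^{3n+2}}{(3n+2)!}-E_{3n+3}\frac{x^{3n+3}}{(3n+3)!}\bigr)}{Q(x)}. \] Moreover these equal, respectively, \[ \frac{2\sqrt3\sinh(\frac12\sqrt3x)}{3\cos(\frac12x)-\sqrt3\sinh(\frac12\sqrt3x)}\quad\text{and}\quad \frac{3\sin(\frac12x)-3\cos(\frac12x)+3\cosh(\frac12\sqrt3x)-\sqrt3\sinh(\frac12\sqrt3x)}{3\cos(\frac12x)-\sqrt3\sinh(\frac12\sqrt3x)}. \]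
   Context: For $\pi\in\mathfrak S_n$, $i\in[n-1]$ is an alternating descent if $i$ odd and $\pi_i>\pi_{i+1}$, or $i$ even and $\pi_i<\pi_{i+1}$. An alternating run is a maximal block of consecutive entries containing no alternating descent; the last alternating run is the one containing $\pi_n$. $E_n$: $\sum E_nx^n/n!=\sec x+\tan x$. *)

(* Defs.v *)
From mathcomp Require Import all_boot all_fingroup.
Set Implicit Arguments. Unset Strict Implicit. Unset Printing Implicit Defensive.

(* one-line notation of a permutation s of 'I_n (values 0..n-1; order
   comparisons are the same as for [n] = {1..n}) *)
Definition perm_word (n : nat) (s : 'S_n) : seq nat :=
  [seq val (s i) | i <- enum 'I_n].

(* For a word w = w_1 ... w_n, the list of booleans b_1 ... b_{n-1} with
   b_i = "i is an alternating descent":  i odd and w_i > w_{i+1}, or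
   i even and w_i < w_{i+1}.  Here j = i-1 is the 0-based index, so
   i odd <-> j even. *)
Definition altdes (w : seq nat) : seq bool :=
  [seq (if odd j then nth 0 w j < nth 0 w j.+1 else nth 0 w j.+1 < nth 0 w j)
  | j <- iota 0 (size w).-1].

(* Lengths of the alternating runs (maximal blocks of consecutive entries
   containing no alternating descent), left to right.  Reading b_i: if i is an
   alternating descent, the current run (ending at position i) is closed. *)
Fixpoint runs_aux (ds : seq bool) (cur : nat) : seq nat :=
  match ds with
  | [::] => [:: cur]
  | b :: ds' => if b then cur :: runs_aux ds' 1 else runs_aux ds' cur.+1
  end.

Definition alt_runs (w : seq nat) : seq nat := runs_aux (altdes w) 1.

Definition good_perm (k n : nat) (s : 'S_n) : bool :=
  all (fun l => l < 3) (alt_runs (perm_word s)) &&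
  (last 0 (alt_runs (perm_word s)) == k).

Definition count_good (k n : nat) : nat := #|[pred s : 'S_n | good_perm k s]|.

Definition cnum (n : nat) : nat := if n is 0 then 0 else count_good 1 n.
Definition dnum (n : nat) : nat := if n is 0 then 0 else count_good 2 n.

(* Main.v *)
(** Cut a permutation at its maximum, w = u m v. If |u| is even, then m forms an
alternating run by itself, and v is counted with the parity of the positions
flipped, which complementing the values undoes; if |u| is odd, then m lies in the
runs of both neighbours, so v is empty and u ends with a run of length 1. Hence,
with u = 1 + sum c(n) x^n/n! and B = sum d(n) x^n/n!, and F the even part of u + B,
one has u' = F u and B' = F B + (odd part of u), a system for
u(x), u(-x), B(x), B(-x) which the closed forms solve as well. On the other side,
splitting sec + tan by residues of the exponent mod 3 amounts to evaluating it at
w x, w a primitive cube root of unity; the equation 2 f' = 1 + f^2 turns into a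
system for two real series, solved by explicit functions. Both identifications are
Gronwall uniqueness near 0. *)
Require Import Defs.
From mathcomp Require all_boot all_fingroup.
From Stdlib Require Import Reals Factorial Lra Lia.
From Coquelicot Require Import Coquelicot.
Open Scope R_scope.

Module Combinatorics.
Import all_boot all_fingroup.
Set Implicit Arguments. Unset Strict Implicit. Unset Printing Implicit Defensive.
Local Open Scope nat_scope.

(** * Good words and their recurrence *)

Definition desc (p : bool) (x y : nat) : bool := if p then x < y else y < x.

(** A one-pass scan: [x] is the letter just read, [p] the parity of its 0-based position, [c] the
    length so far of the run containing it. Runs are tested as they close, so a scan can restart at
    any letter with either parity. *)
Fixpoint good_from (p : bool) (k x c : nat) (w : seq nat) : bool :=
  if w is y :: w' then
    if desc p x y then (c < 3) && good_from (~~ p) k y 1 w'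
    else good_from (~~ p) k y c.+1 w'
  else (c < 3) && (c == k).

(** The empty word is given a last run of length 1. This matches [alt_runs [::]], supplies the
    constant term of [u], and lets the cut below cover an extremal letter at either end without a
    special case. *)
Definition good (p : bool) (k : nat) (w : seq nat) : bool :=
  if w is x :: w' then good_from p k x 1 w' else k == 1.

Lemma runs_aux_neq0 ds c : runs_aux ds c <> [::].
Proof. by elim: ds c => [|[] ds IH] c //=. Qed.

(** The offset [i] makes the induction go through: removing the first letter shifts all positions by
    one, and the scan feels only the parity of [i]. *)
Lemma good_from_runs (w : seq nat) k x c i :
  all (fun l => l < 3)
    (runs_aux [seq (if odd j then nth 0 (x :: w) (j - i) < nth 0 (x :: w) (j.+1 - i)
                    else nth 0 (x :: w) (j.+1 - i) < nth 0 (x :: w) (j - i))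
              | j <- iota i (size w)] c) &&
  (last 0
    (runs_aux [seq (if odd j then nth 0 (x :: w) (j - i) < nth 0 (x :: w) (j.+1 - i)
                    else nth 0 (x :: w) (j.+1 - i) < nth 0 (x :: w) (j - i))
              | j <- iota i (size w)] c) == k)
  = good_from (odd i) k x c w.
Proof.
elim: w x c i => [|y w IH] x c i; first by rewrite /= andbT.
have E : [seq (if odd j then nth 0 (x :: y :: w) (j - i) < nth 0 (x :: y :: w) (j.+1 - i)
                    else nth 0 (x :: y :: w) (j.+1 - i) < nth 0 (x :: y :: w) (j - i))
              | j <- iota i.+1 (size w)] =
   [seq (if odd j then nth 0 (y :: w) (j - i.+1) < nth 0 (y :: w) (j.+1 - i.+1)
                    else nth 0 (y :: w) (j.+1 - i.+1) < nth 0 (y :: w) (j - i.+1))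
              | j <- iota i.+1 (size w)].
  apply/eq_in_map => j; rewrite mem_iota => /andP[lij _].
  by rewrite subSS (subSn (ltnW lij)) -(subnSK lij).
have -> : iota i (size (y :: w)) = i :: iota i.+1 (size w) by [].
rewrite map_cons E subnn subSnn.
rewrite [nth 0 (x :: y :: w) 0]/= [nth 0 (x :: y :: w) 1]/=.
rewrite [good_from _ _ _ _ _]/= /desc -[~~ odd i]/(odd i.+1).
case: (if odd i then _ else _); last by rewrite /= IH.
rewrite [runs_aux _ _]/= [all _ _]/= -andbA.
congr andb; rewrite -IH; congr andb.
set ds := map _ _.
(* Prepending a closed run keeps the last run, because the rest is nonempty. *)
by case: (runs_aux ds 1) (@runs_aux_neq0 ds 1).
Qed.

Lemma good_alt_runs (w : seq nat) k :
  all (fun l => l < 3) (alt_runs w) && (last 0 (alt_runs w) == k) = good false k w.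
Proof.
case: w => [|x w]; first by rewrite /= eq_sym.
rewrite /alt_runs /altdes /= -(good_from_runs w k x 1 0).
suff -> : [seq (if odd j then nth 0 (x :: w) j < nth 0 (x :: w) j.+1
                else nth 0 (x :: w) j.+1 < nth 0 (x :: w) j) | j <- iota 0 (size w)]
  = [seq (if odd j then nth 0 (x :: w) (j - 0) < nth 0 (x :: w) (j.+1 - 0)
                    else nth 0 (x :: w) (j.+1 - 0) < nth 0 (x :: w) (j - 0))
              | j <- iota 0 (size w)] by [].
by apply/eq_map => j; rewrite !subn0.
Qed.

(* A maximal letter (e = false) or a minimal letter (e = true) at a position of
   parity e forms a run of its own; at a position of parity ~~ e it belongs to
   the runs of both of its neighbours. *)
Section Extremal.
Variables (e : bool) (m : nat).

Lemma desc_extr x : desc e m x -> (desc (~~ e) x m = true) * (desc e x m = false) *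
   (desc (~~ e) m x = false).
Proof. by rewrite /desc; case: e => /= h; rewrite h !ltnNge (ltnW h). Qed.

Lemma good_from_ge3 p k x c w : 2 < c -> good_from p k x c w = false.
Proof.
elim: w p x c => [|y w IH] p x c c3 /=; first by rewrite ltnNge c3.
by case: ifP => _; [rewrite ltnNge c3 | rewrite IH // ltnW].
Qed.

(** The test compares the parity of the position of [m], which is [~~ (p (+) odd (size u))], with
    [e]. If they agree, [m] is isolated: the run before it closes with length 1 or 2, and [v] is
    scanned afresh from parity [~~ e]. Otherwise a letter after [m] would make a run of length at
    least 3, so [v] is empty and [m] is the second letter of the last run. *)
Lemma good_from_split p k x c u v : 0 < c -> 0 < k < 3 ->
  all (desc e m) (x :: u) -> all (desc e m) v ->
  good_from p k x c (u ++ m :: v) =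
  if p (+) odd (size u) (+) e then
    (good_from p 1 x c u || good_from p 2 x c u) && good (~~ e) k v
  else [&& v == [::], k == 2 & good_from p 1 x c u].
Proof.
move=> c0 hk; elim: u p x c c0 => [|y u IH] p x c c0 /=.
  rewrite andbT => hx hv; have [[h1 h2] _] := desc_extr hx.
  (* Here [p] is the parity of the letter just before [m]; for [p = e], [m] joins its run. *)
  have := h1; have := h2; case: (altP (p =P e)) => [-> {h1} h1 _| npe _ {h2} h2].
    rewrite h1 addbF addbb; case: v hv => [|y v] /=.
      by move: hk; case: k => [|[|[|k]]] //; case: c c0 => [|[|[|c]]].
    case/andP=> hy _; have [_ ->] := desc_extr hy.
    by rewrite good_from_ge3.
  have -> : p = ~~ e by case: p e npe => [] [].
  rewrite h2 addbF addNb addbb /= negbK.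
  have -> : (c < 3) = (c == 1) || (c == 2) by case: c c0 => [|[|[|c]]].
  rewrite (_ : good_from e k m 1 v = good (~~ e) k v).
    by case: c c0 => [|[|[|c]]].
  case: v hv => [|y v] /=; first by rewrite eq_sym.
  by case/andP=> ->.
case/and3P=> hx hy hu hv.
rewrite !IH //= ?hy ?hu // addbN -addNb.
by case: (desc p x y); case: ifP => _ //; case: (c < 3); rewrite //= !andbF.
Qed.

Lemma good_split k u v : 0 < k < 3 ->
  all (desc e m) u -> all (desc e m) v ->
  good e k (u ++ m :: v) =
  if odd (size u) then [&& v == [::], k == 2 & good e 1 u]
  else (good e 1 u || good e 2 u) && good (~~ e) k v.
Proof.
case: u => [|x u] hk hu hv /=.
  case: v hv => [|y v] /=; first by rewrite eq_sym.
  by case/andP=> ->.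
rewrite good_from_split //.
by rewrite addbAC addbb addFb if_neg.
Qed.

End Extremal.

(** Exclusiveness of the two last lengths turns the disjunctions of the split into sums of
    counts. *)
Lemma good_from_disjoint p x c w : good_from p 1 x c w && good_from p 2 x c w = false.
Proof.
elim: w p x c => [|y w IH] p x c /=; first by case: c => [|[|[|c]]].
by case: (desc p x y); rewrite ?IH //; case: (c < 3); rewrite //= ?IH.
Qed.

Lemma good_disjoint p w : good p 1 w && good p 2 w = false.
Proof. by case: w => [|x w] //=; apply: good_from_disjoint. Qed.

(** * Counting arrangements of a finite set by cutting at an extremal letter *)

Section Words.
Variable N : nat.
Implicit Types (A U : {set 'I_N}) (m : 'I_N).

Definition words A : seq (seq 'I_N) := permutations (enum A).

Lemma mem_words A w : (w \in words A) = uniq w && (w \subset A) && (A \subset w).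
Proof.
rewrite mem_permutations; apply/idP/idP.
  move=> h; rewrite (perm_uniq h) enum_uniq /=.
  by apply/andP; split; apply/subsetP => x; rewrite (perm_mem h) mem_enum.
case/andP => /andP[uw /subsetP h1] /subsetP h2.
apply: uniq_perm => //; first exact: enum_uniq.
by move=> x; rewrite mem_enum; apply/idP/idP => [/h1|/h2].
Qed.

Lemma words_uniq A : uniq (words A).
Proof. exact: permutations_uniq. Qed.

Definition before m (w : seq 'I_N) : {set 'I_N} := [set x in take (index m w) w].

Lemma before_cat m u v : uniq (u ++ m :: v) -> before m (u ++ m :: v) = [set x in u].
Proof.
rewrite cat_uniq /= => /and3P[_ /norP[mu _] _].
by rewrite /before index_cat (negbTE mu) /= eqxx addn0 take_size_cat.
Qed.

(** Fixing the set [U] of letters before [m] leaves a free choice of an arrangement on each side.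
    The two factors can be recovered because all arrangements of [U] have the same length. *)
Lemma words_before A m U : m \in A -> U \subset A :\ m ->
  perm_eq [seq w <- words A | before m w == U]
    [seq u ++ m :: v | u <- words U, v <- words ((A :\ m) :\: U)].
Proof.
move=> mA sU; apply: uniq_perm.
- by rewrite filter_uniq ?words_uniq.
- apply: allpairs_uniq; try exact: words_uniq.
  move=> [u v] [u' v'] /allpairsP[[u1 v1] /= [h1 h2 [-> ->]]].
  move=> /allpairsP[[u2 v2] /= [h3 h4 [-> ->]]] E.
  have sz : size u1 = size u2.
    by move: h1 h3; rewrite !mem_permutations => /perm_size -> /perm_size ->.
  by move/eqP: E; rewrite eqseq_cat //= eqseq_cons eqxx => /andP[/eqP -> /eqP ->].
- move=> w; rewrite mem_filter; apply/idP/idP.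
  + case/andP => /eqP bw; rewrite mem_words => /andP[/andP[uw /subsetP wA] /subsetP Aw].
    have mw := Aw _ mA.
    move: bw uw wA Aw; case/splitPr: mw => u v bw uw wA Aw.
    have bu := bw; rewrite before_cat // in bu.
    have := uw; rewrite cat_uniq /= => /and4P[uu /norP[mu /hasPn uv] mv vv].
    apply/allpairsP; exists (u, v); split=> //=; rewrite mem_words.
      rewrite uu -bu /=; apply/andP; split; apply/subsetP => x; by rewrite inE.
    rewrite vv -bu /=; apply/andP; split; apply/subsetP => x; rewrite !inE.
      move=> xv; rewrite (uv _ xv) wA ?mem_cat ?inE ?xv ?orbT // andbT.
      by apply: contraNneq mv => <-.
    case/and3P => xu xm /Aw; by rewrite mem_cat inE (negbTE xu) (negbTE xm).
  + case/allpairsP => [[u v] /= [hu hv ->]].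
    move: hu hv; rewrite !mem_words => /andP[/andP[uu /subsetP us] /subsetP su].
    case/andP => /andP[vv /subsetP vs] /subsetP sv.
    have mU : m \notin U by apply/negP => /(subsetP sU); rewrite !inE eqxx.
    have uw : uniq (u ++ m :: v).
      rewrite cat_uniq uu /= vv andbT; apply/andP; split.
      - rewrite negb_or; apply/andP; split.
          by apply: contra mU => /us.
        apply/hasPn => x /vs; rewrite !inE => /andP[xU _].
        by apply: contra xU => /us.
      - by apply/negP => /vs; rewrite !inE eqxx andbF.
    rewrite before_cat // uw /=; apply/and3P; split.
    * by apply/eqP/setP => x; rewrite inE; apply/idP/idP => [/us|/su].
    * apply/subsetP => x; rewrite mem_cat inE => /or3P[/us/(subsetP sU)|/eqP->//|/vs].
        by rewrite !inE => /andP[].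
      by rewrite !inE => /and3P[].
    * apply/subsetP => x xA; rewrite mem_cat inE.
      case xU: (x \in U); first by rewrite su.
      case: (altP (x =P m)) => [//|xm]; first by rewrite orbT.
      by rewrite sv ?orbT // !inE xU xm.
Qed.

Lemma sum_words_split A m (F : seq 'I_N -> nat) : m \in A ->
  \sum_(w <- words A) F w =
  \sum_(U in powerset (A :\ m)) \sum_(u <- words U)
    \sum_(v <- words ((A :\ m) :\: U)) F (u ++ m :: v).
Proof.
move=> mA; rewrite big_seq.
rewrite (partition_big (before m) (fun U => U \in powerset (A :\ m))) /=; last first.
  move=> w; rewrite mem_words powersetE => /andP[/andP[uw /subsetP wA] /subsetP Aw].
  have mw := Aw _ mA; move: uw wA {Aw}; case/splitPr: mw => u v uw wA.
  rewrite before_cat //; apply/subsetP => x; rewrite !inE => xu.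
  rewrite wA ?mem_cat ?xu // andbT; apply: contraTneq uw => <-.
  by rewrite cat_uniq /= xu /= andbF.
apply: eq_bigr => U; rewrite powersetE => sU.
rewrite -big_seq_cond -big_filter (perm_big _ (words_before mA sU)).
by rewrite big_allpairs_dep.
Qed.

Lemma size_word A w : w \in words A -> size w = #|A|.
Proof. by rewrite mem_permutations cardE => /perm_size. Qed.

Lemma word_in A w x : w \in words A -> x \in w -> x \in A.
Proof. by rewrite mem_permutations => /perm_mem ->; rewrite mem_enum. Qed.

Lemma words_set0 : words set0 = [:: [::]].
Proof. by rewrite /words enum_set0. Qed.

(** The starting parity is a parameter because the factor after an isolated letter starts at the
    opposite parity. *)
Definition num (p : bool) (k : nat) A : nat :=
  \sum_(w <- words A) good p k [seq val i | i <- w].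

Lemma num_set0 p k : num p k set0 = (k == 1).
Proof. by rewrite /num words_set0 big_seq1. Qed.

Lemma sum_words_nil A : \sum_(w <- words A) (w == [::] :> seq 'I_N) = (A == set0) :> nat.
Proof.
case: (altP (A =P set0)) => [->|nA]; first by rewrite words_set0 big_seq1.
rewrite big_seq big1 // => w /size_word sw.
by case: w sw => [|//] /esym/eqP; rewrite cards_eq0 (negbTE nA).
Qed.

(** This sums [good_split] over all cuts. For odd [#|U|], emptiness of the right factor reads
    [U == A :\ m]; for even [#|U|], the sum over pairs of factors is a product. *)
Lemma num_split e k A m : 0 < k < 3 -> m \in A ->
  (forall x, x \in A :\ m -> desc e m x) ->
  num e k A = \sum_(U in powerset (A :\ m))
    (if odd #|U| then (U == A :\ m) * (k == 2) * num e 1 U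
     else (num e 1 U + num e 2 U) * num (~~ e) k ((A :\ m) :\: U)).
Proof.
move=> hk mA ext; rewrite /num (sum_words_split _ mA).
apply: eq_bigr => U; rewrite powersetE => sU.
have ext_word (V : {set 'I_N}) w : V \subset A :\ m -> w \in words V ->
    all (desc e m) [seq val i | i <- w].
  move=> sV hw; rewrite all_map; apply/allP => x xw /=.
  by apply: ext; apply: (subsetP sV); apply: word_in xw.
have split_word u v : u \in words U -> v \in words ((A :\ m) :\: U) ->
    nat_of_bool (good e k [seq val i | i <- u ++ m :: v]) =
    if odd #|U| then (v == [::]) * ((k == 2) * good e 1 [seq val i | i <- u])
    else (good e 1 [seq val i | i <- u] + good e 2 [seq val i | i <- u])
         * good (~~ e) k [seq val i | i <- v].
  move=> hu hv; rewrite map_cat map_cons (good_split (e := e)) //.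
  - rewrite size_map (size_word hu); case: ifP => _.
      rewrite -!mulnb; congr (nat_of_bool _ * _); by case: (v).
    rewrite -mulnb; congr (_ * _).
    move: (good_disjoint e [seq val i | i <- u]).
    by case: (good e 1 _) => //=; case: (good e 2 _).
  - exact: ext_word hu.
  - apply: ext_word hv; exact: subsetDl.
transitivity (\sum_(u <- words U) \sum_(v <- words ((A :\ m) :\: U))
    if odd #|U| then (v == [::]) * ((k == 2) * good e 1 [seq val i | i <- u])
    else (good e 1 [seq val i | i <- u] + good e 2 [seq val i | i <- u])
         * good (~~ e) k [seq val i | i <- v]).
  apply: eq_big_seq => u hu; apply: eq_big_seq => v hv; exact: split_word.
case: ifP => _.
  under eq_bigr => u _ do rewrite -big_distrl sum_words_nil /=.
  rewrite -big_distrr -big_distrr /= mulnA; congr (nat_of_bool _ * _ * _).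
  by rewrite setD_eq0 eqEsubset sU.
rewrite -big_split big_distrl; apply: eq_bigr => u _ /=.
by rewrite big_distrr.
Qed.

(** The letter is the maximum for [e = false] and the minimum for [e = true]. *)
Lemma exists_extremal e A : A != set0 ->
  exists2 m, m \in A & forall x, x \in A :\ m -> desc e m x.
Proof.
case/set0Pn => i0 i0A; case: e.
  case: (@arg_minnP _ i0 (mem A) val i0A) => m mA H; exists m => // x.
  by rewrite !inE => /andP[xm /H]; rewrite leq_eqVlt eq_sym (inj_eq val_inj) (negbTE xm).
case: (@arg_maxnP _ i0 (mem A) val i0A) => m mA H; exists m => // x.
by rewrite !inE => /andP[xm /H]; rewrite /= leq_eqVlt (inj_eq val_inj) (negbTE xm).
Qed.

Lemma sum_powerset_card A (f : nat -> nat) :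
  \sum_(U in powerset A) f #|U| = \sum_(j < #|A|.+1) 'C(#|A|, j) * f j.
Proof.
(* Sizes of subsets of [A] are below [#|A|.+1], so [inord] returns them unchanged. *)
rewrite (partition_big (fun U : {set 'I_N} => inord #|U| : 'I_#|A|.+1) predT) //=.
apply: eq_bigr => j _.
have E U : (U \in powerset A) && (inord #|U| == j) = (U \subset A) && (#|U| == j).
  rewrite powersetE; case sU: (U \subset A) => //=.
  by rewrite -(inj_eq val_inj) /= inordK // ltnS subset_leq_card.
rewrite (eq_bigl _ _ E) (eq_bigr (fun=> f j)) => [|U /andP[_ /eqP->] //].
by rewrite sum_nat_const -cards_draws cardsE.
Qed.

End Words.

Definition gnum (k n : nat) : nat := num false k [set: 'I_n].

(** The contribution of one set of [j] letters placed before the extremal letter, out of the [n]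
    other letters. *)
Definition gnum_rec (k n j : nat) : nat :=
  if odd j then (j == n) * (k == 2) * gnum 1 j
  else (gnum 1 j + gnum 2 j) * gnum k (n - j).

(** The right side is free of [p]: cutting at the maximum for [p = false] and at the minimum for
    [p = true] yields the same recurrence. This does the work of complementing the values. *)
Lemma num_rec n N (A : {set 'I_N}) p k : 0 < k < 3 -> #|A| = n.+1 ->
  (forall p k (U : {set 'I_N}), 0 < k < 3 -> #|U| <= n -> num p k U = gnum k #|U|) ->
  num p k A = \sum_(j < n.+1) 'C(n, j) * gnum_rec k n j.
Proof.
move=> hk cA IH.
have nA : A != set0 by rewrite -cards_eq0 cA.
have [m mA ext] := exists_extremal p nA.
have cA' : #|A :\ m| = n by move: (cardsD1 m A); rewrite mA cA => -[].
have := sum_powerset_card (A :\ m) (gnum_rec k n); rewrite cA' => <-.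
rewrite (num_split hk mA ext); apply: eq_bigr => U; rewrite powersetE => sU.
have cU := subset_leq_card sU; rewrite cA' in cU.
rewrite /gnum_rec !IH //; last by rewrite -cA' subset_leq_card // subsetDl.
rewrite cardsD (setIidPr sU) cA' -{2}cA'.
case: ifP => _ //; congr (nat_of_bool _ * _ * _).
by apply/eqP/eqP => [->//|h]; apply/eqP; rewrite eqEcard sU h leqnn.
Qed.

Lemma num_card N (A : {set 'I_N}) p k : 0 < k < 3 -> num p k A = gnum k #|A|.
Proof.
move: {2}#|A| (leqnn #|A|) => n; elim: n N A p k => [|n IH] N A p k.
  rewrite leqn0 cards_eq0 => /eqP -> _.
  by rewrite cards0 /gnum (_ : [set: 'I_0] = set0) ?num_set0 //; apply/setP => -[].
rewrite leq_eqVlt => /orP[/eqP cA|cA] hk; last exact: IH.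
(* Both counts expand into the same sum, once for [A] and once for the full set of [n.+1]
   letters. *)
rewrite cA /gnum (@num_rec n N) //; last by move=> *; apply: IH.
by rewrite (@num_rec n n.+1) ?cardsT ?card_ord //; move=> *; apply: IH.
Qed.

Lemma gnum_succ k n : 0 < k < 3 ->
  gnum k n.+1 = \sum_(j < n.+1) 'C(n, j) * gnum_rec k n j.
Proof.
move=> hk; apply: num_rec => //; first by rewrite cardsT card_ord.
by move=> *; apply: num_card.
Qed.

Lemma gnum0 k : gnum k 0 = (k == 1).
Proof. by rewrite /gnum (_ : [set: 'I_0] = set0) ?num_set0 //; apply/setP => -[]. Qed.

(** * From words back to permutations *)

Lemma words_setT n :
  perm_eq (words [set: 'I_n]) [seq [seq s i | i <- enum 'I_n] | s : 'S_n].
Proof.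
have u : uniq [seq [seq s i | i <- enum 'I_n] | s : 'S_n].
  rewrite map_inj_uniq ?enum_uniq // => s t E; apply/permP => i.
  by have /eq_in_map := E; apply; rewrite mem_enum.
rewrite perm_sym; apply: uniq_perm => //; first exact: words_uniq.
(* One inclusion suffices: both lists are duplicate-free and have [n!] elements. *)
apply: (uniq_min_size u _ _).2.
  move=> w /mapP[s _ ->]; rewrite mem_words map_inj_uniq ?enum_uniq /=; last exact: perm_inj.
  apply/andP; split; apply/subsetP => x; first by rewrite inE.
  move=> _; apply/mapP; exists ((s^-1)%g x).
    by rewrite mem_enum.
  by rewrite permKV.
rewrite size_permutations ?enum_uniq // -cardE cardsT card_ord size_map -cardE.
by rewrite card_Sn.
Qed.

Lemma count_good_gnum k n : count_good k n = gnum k n.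
Proof.
rewrite /gnum /num (perm_big _ (words_setT n)) big_map big_enum /=.
rewrite /count_good -sum1_card big_mkcond; apply: eq_bigr => s _.
rewrite unfold_in /= /good_perm good_alt_runs /perm_word -map_comp.
by case: (good _ _ _).
Qed.

Lemma gnum_le k n : gnum k n <= n`!.
Proof.
rewrite -count_good_gnum /count_good; apply: leq_trans (max_card _) _.
by rewrite card_Sn.
Qed.

(** Among odd [j] only [j = n] survives, and it becomes a boundary term. What remains is a binomial
    convolution with the even-indexed part of [gnum 1 + gnum 2]. *)
Lemma gnum_succ_even k n : 0 < k < 3 ->
  gnum k n.+1 =
    \sum_(j < n.+1) 'C(n, j) * (if odd j then 0 else (gnum 1 j + gnum 2 j) * gnum k (n - j))
    + odd n * ((k == 2) * gnum 1 n).
Proof.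
move=> hk; rewrite gnum_succ // !big_ord_recr /= /gnum_rec eqxx binn !mul1n.
rewrite -addnA; congr (_ + _).
  apply: eq_bigr => j _; congr (_ * _).
  by rewrite (ltn_eqF (ltn_ord j)).
by case: (odd n); rewrite ?add0n ?mul1n // mul0n addn0.
Qed.

(** * Exponential coefficients as real numbers *)

Local Open Scope R_scope.

Lemma INR_sum n (F : nat -> nat) :
  INR (\sum_(j < n.+1) F j)%N = sum_f_R0 (fun j => INR (F j)) n.
Proof.
elim: n => [|n IH]; first by rewrite big_ord_recr big_ord0 /= add0n.
by rewrite big_ord_recr /= plus_INR IH.
Qed.

Lemma factorial_fact n : n`!%N = fact n.
Proof. by elim: n => //= n IH; rewrite factS IH. Qed.

Definition weight (k n : nat) : R := INR (gnum k n) / INR (fact n).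

(** The coefficient form of [u' = F u] and [B' = F B + (odd part of u)]: the left side is a
    coefficient of the derivative, the sum a Cauchy product with [F]. *)
Lemma weight_succ k n : (0 < k < 3)%N ->
  INR n.+1 * weight k n.+1 =
    sum_f_R0 (fun j => (if odd j then 0 else weight 1 j + weight 2 j)
                       * weight k (n - j)%coq_nat) n
    + (if odd n && (k == 2%N) then weight 1 n else 0).
Proof.
move=> hk; rewrite {1}/weight gnum_succ_even // plus_INR.
rewrite (INR_sum n (fun j => 'C(n, j) *
  (if odd j then 0 else (gnum 1 j + gnum 2 j) * gnum k (n - j)))%N).
have fn (i : nat) : INR (fact i) <> 0 by exact: INR_fact_neq_0.
have -> : INR (fact n.+1) = INR n.+1 * INR (fact n) by rewrite -mult_INR.
have n0 : INR n.+1 <> 0 by apply: not_0_INR.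
rewrite Rdiv_plus_distr Rmult_plus_distr_l; congr (_ + _).
  have -> (S : R) : INR n.+1 * (S / (INR n.+1 * INR (fact n))) = / INR (fact n) * S.
    by field.
  rewrite scal_sum; apply: PartSum.sum_eq => j /leP jn.
  rewrite mult_INR; case: ifP => _; first by rewrite /= Rmult_0_r !Rmult_0_l.
  rewrite mult_INR plus_INR /weight.
  have := bin_fact jn; rewrite !factorial_fact => <-; rewrite !mult_INR.
  have h : INR 'C(n, j) <> 0 by apply: not_0_INR; apply/eqP; rewrite -lt0n bin_gt0.
  by rewrite !minusE; field; repeat split.
case: (odd n); rewrite ?mul0n ?mul1n; last by rewrite [RHS]/=; change (INR 0) with 0; field.
case: (k == 2%N); rewrite ?mul1n ?mul0n; last by rewrite [RHS]/=; change (INR 0) with 0; field.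
by rewrite [RHS]/= /weight; field.
Qed.

Lemma weight_0 k : weight k 0 = if k == 1%N then 1 else 0.
Proof. by rewrite /weight gnum0; case: (k == _) => /=; field. Qed.

(** There are at most [n!] good permutations; hence the weight series have radius of convergence at
    least 1. *)
Lemma weight_bounds k n : 0 <= weight k n <= 1.
Proof.
have fn : 0 < INR (fact n) by exact: INR_fact_lt_0.
split; first by apply: Rle_mult_inv_pos => //; exact: pos_INR.
apply: (Rmult_le_reg_r _ _ _ fn); rewrite /weight Rmult_1_l /Rdiv Rmult_assoc Rinv_l; last lra.
by rewrite Rmult_1_r; apply/le_INR/leP; rewrite -factorial_fact gnum_le.
Qed.

Lemma weight1_succ n : INR n.+1 * weight 1 n.+1 =
  sum_f_R0 (fun j => (if odd j then 0 else weight 1 j + weight 2 j)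
                     * weight 1 (n - j)%coq_nat) n.
Proof. by rewrite weight_succ // andbF Rplus_0_r. Qed.

Lemma weight2_succ n : INR n.+1 * weight 2 n.+1 =
  sum_f_R0 (fun j => (if odd j then 0 else weight 1 j + weight 2 j)
                     * weight 2 (n - j)%coq_nat) n + (if odd n then weight 1 n else 0).
Proof. by rewrite weight_succ // andbT. Qed.

(** Stated at [n.+1] because at 0 the weight is 1 whereas [cnum 0] is 0. For [dnum] the two agree at
    0. *)
Lemma weight_cnum n : INR (cnum n.+1) / INR (fact n.+1) = weight 1 n.+1.
Proof. by rewrite /weight -count_good_gnum. Qed.

Lemma weight_dnum n : INR (dnum n) / INR (fact n) = weight 2 n.
Proof. by case: n => [|n]; rewrite /weight ?gnum0 // -count_good_gnum. Qed.

End Combinatorics.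

(** * Uniqueness for the two differential systems *)

(** By the mean value theorem, [W t * exp (- K t)] cannot increase and [W t * exp (K t)] cannot
    decrease. Starting from [W 0 = 0], the first forces [W x <= 0] to the right of 0 and the second
    to the left. *)
Lemma gronwall_zero (W dW : R -> R) (K r : R) :
  (forall x, Rabs x < r -> is_derive W x (dW x) /\ 0 <= W x /\ Rabs (dW x) <= K * W x) ->
  W 0 = 0 -> forall x, Rabs x < r -> W x = 0.
Proof.
intros H W0 x Hx.
assert (Hin : forall c, Rmin 0 x <= c <= Rmax 0 x -> Rabs c < r).
{ intros c; unfold Rmin, Rmax; destruct (Rle_dec 0 x); intros [h1 h2];
    apply Rabs_def2 in Hx; apply Rabs_def1; lra. }
assert (HV : forall s c, Rabs c < r ->
   is_derive (fun t => W t * exp (s * K * t)) c ((dW c + s * K * W c) * exp (s * K * c))).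
{ intros s c Hc; destruct (H c Hc) as [h _].
  auto_derive; [exists (dW c); exact h|].
  replace (Derive (fun t => W t) c) with (dW c) by (symmetry; apply is_derive_unique; exact h).
  ring. }
assert (Hle : exists s, W x * exp (s * K * x) <= 0).
{ assert (Hm : forall s, exists c, Rmin 0 x <= c <= Rmax 0 x /\
      W x * exp (s * K * x) - W 0 * exp (s * K * 0) =
      (dW c + s * K * W c) * exp (s * K * c) * (x - 0)).
  { intro s.
    apply (MVT_gen (fun t => W t * exp (s * K * t)) 0 x
             (fun c => (dW c + s * K * W c) * exp (s * K * c))).
    - intros c Hc; apply HV, Hin; lra.
    - intros c Hc; apply derivable_continuous_pt.
      exists ((dW c + s * K * W c) * exp (s * K * c)).
      apply is_derive_Reals, HV, Hin, Hc. }
  destruct (Rle_dec 0 x) as [hx|hx].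
  - exists (-1); destruct (Hm (-1)) as [c [Hc E]]; rewrite W0 in E.
    destruct (H c (Hin c Hc)) as [_ [_ h]].
    assert (h' := Rle_trans _ _ _ (Rle_abs _) h).
    assert (e0 := exp_pos (-1 * K * c)).
    assert (h2 : 0 <= (K * W c - dW c) * exp (-1 * K * c) * x).
    { repeat apply Rmult_le_pos; lra. }
    lra.
  - exists 1; destruct (Hm 1) as [c [Hc E]]; rewrite W0 in E.
    destruct (H c (Hin c Hc)) as [_ [_ h]].
    rewrite <- Rabs_Ropp in h.
    assert (h' := Rle_trans _ _ _ (Rle_abs _) h).
    assert (e0 := exp_pos (1 * K * c)).
    assert (h2 : 0 <= (K * W c + dW c) * exp (1 * K * c) * (- x)).
    { repeat apply Rmult_le_pos; lra. }
    lra. }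
destruct Hle as [s Hs]; destruct (H x Hx) as [_ [h _]].
assert (e0 := exp_pos (s * K * x)).
destruct (Rle_lt_or_eq_dec _ _ h) as [h'|h']; [|now symmetry].
assert (0 < W x * exp (s * K * x)) by now apply Rmult_lt_0_compat.
lra.
Qed.

(** Gronwall is applied to the sum of squares [W]. With [S] the sum of absolute values,
    [|W'| <= 2 C S^2] and [S^2 <= 4 W], whence the constant [8 C]. *)
Lemma linear_ode_zero (z0 z1 z2 z3 d0 d1 d2 d3 : R -> R) (C r : R) :
  (forall x, Rabs x < r ->
     let B := C * (Rabs (z0 x) + Rabs (z1 x) + Rabs (z2 x) + Rabs (z3 x)) in
     (is_derive z0 x (d0 x) /\ is_derive z1 x (d1 x) /\
      is_derive z2 x (d2 x) /\ is_derive z3 x (d3 x)) /\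
     Rabs (d0 x) <= B /\ Rabs (d1 x) <= B /\ Rabs (d2 x) <= B /\ Rabs (d3 x) <= B) ->
  z0 0 = 0 -> z1 0 = 0 -> z2 0 = 0 -> z3 0 = 0 -> 0 <= C ->
  forall x, Rabs x < r -> z0 x = 0 /\ z1 x = 0 /\ z2 x = 0 /\ z3 x = 0.
Proof.
intros H h0 h1 h2 h3 HC.
assert (HW : forall x, Rabs x < r -> z0 x ^ 2 + z1 x ^ 2 + z2 x ^ 2 + z3 x ^ 2 = 0).
{ apply (gronwall_zero (fun x => z0 x ^ 2 + z1 x ^ 2 + z2 x ^ 2 + z3 x ^ 2)
    (fun x => 2 * (z0 x * d0 x + z1 x * d1 x + z2 x * d2 x + z3 x * d3 x)) (8 * C) r).
  2: rewrite h0, h1, h2, h3; ring.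
  intros x Hx; destruct (H x Hx) as [[D0 [D1 [D2 D3]]] [B0 [B1 [B2 B3]]]].
  split; [|split].
  - auto_derive; [repeat split; eexists; eassumption|].
    replace (Derive (fun t => z0 t) x) with (d0 x) by (symmetry; apply is_derive_unique; exact D0).
    replace (Derive (fun t => z1 t) x) with (d1 x) by (symmetry; apply is_derive_unique; exact D1).
    replace (Derive (fun t => z2 t) x) with (d2 x) by (symmetry; apply is_derive_unique; exact D2).
    replace (Derive (fun t => z3 t) x) with (d3 x) by (symmetry; apply is_derive_unique; exact D3).
    ring.
  - nra.
  - set (S := Rabs (z0 x) + Rabs (z1 x) + Rabs (z2 x) + Rabs (z3 x)) in *.
    assert (T : forall z d, Rabs d <= C * S -> Rabs (z * d) <= Rabs z * (C * S)).
    { intros z d h; rewrite Rabs_mult; apply Rmult_le_compat_l; [apply Rabs_pos|exact h]. }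
    rewrite Rabs_mult, (Rabs_right 2) by lra.
    assert (T1 : Rabs (z0 x * d0 x + z1 x * d1 x + z2 x * d2 x + z3 x * d3 x) <= S * (C * S)).
    { eapply Rle_trans; [apply Rabs_triang|].
      eapply Rle_trans; [apply Rplus_le_compat_r, Rabs_triang|].
      eapply Rle_trans; [apply Rplus_le_compat_r, Rplus_le_compat_r, Rabs_triang|].
      assert (t0 := T (z0 x) _ B0); assert (t1 := T (z1 x) _ B1).
      assert (t2 := T (z2 x) _ B2); assert (t3 := T (z3 x) _ B3).
      unfold S at 1; lra. }
    assert (Q : S * S <= 4 * (z0 x ^ 2 + z1 x ^ 2 + z2 x ^ 2 + z3 x ^ 2)).
    { unfold S; rewrite <- (pow2_abs (z0 x)), <- (pow2_abs (z1 x)),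
        <- (pow2_abs (z2 x)), <- (pow2_abs (z3 x)).
      generalize (Rabs (z0 x)) (Rabs (z1 x)) (Rabs (z2 x)) (Rabs (z3 x)).
      intros a b c d.
      (* The sum of these squares is four times the sum of squares minus the square of the sum. *)
      assert (0 <= (a-b)^2 + (a-c)^2 + (a-d)^2 + (b-c)^2 + (b-d)^2 + (c-d)^2).
      { repeat apply Rplus_le_le_0_compat; apply pow2_ge_0. }
      nra. }
    assert (C * (S * S) <= C * (4 * (z0 x ^ 2 + z1 x ^ 2 + z2 x ^ 2 + z3 x ^ 2)))
      by now apply Rmult_le_compat_l.
    nra. }
intros x Hx; specialize (HW x Hx).
assert (p0 := pow2_ge_0 (z0 x)); assert (p1 := pow2_ge_0 (z1 x)).
assert (p2 := pow2_ge_0 (z2 x)); assert (p3 := pow2_ge_0 (z3 x)).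
assert (sq : forall z, z ^ 2 = 0 -> z = 0).
{ intros z h; rewrite <- Rsqr_pow2 in h; now apply Rsqr_0_uniq. }
repeat split; apply sq; lra.
Qed.

(* For u = 1 + A, with A and B the generating functions of the two families,
   y0, y1, y2, y3 stand for u(x), u(-x), B(x), B(-x); half their sum is the
   even part of u + B. *)
Definition run_system (y0 y1 y2 y3 : R -> R) (x : R) : Prop :=
  let F := (y0 x + y1 x + y2 x + y3 x) / 2 in
  is_derive y0 x (F * y0 x) /\ is_derive y1 x (- F * y1 x) /\
  is_derive y2 x (F * y2 x + (y0 x - y1 x) / 2) /\
  is_derive y3 x (- F * y3 x + (y0 x - y1 x) / 2).

(* For F = sec + tan and w a primitive cube root of unity, F(w x) = p x + w * r x,
   and 2 F' = 1 + F^2 becomes this system. *)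
Definition euler_system (p r : R -> R) (x : R) : Prop :=
  is_derive p x ((r x ^ 2 - 2 * p x * r x) / 2) /\
  is_derive r x ((1 + p x ^ 2 - 2 * p x * r x) / 2).

Lemma locally_bounded (f : R -> R) : ex_derive f 0 ->
  locally 0 (fun x => Rabs (f x) <= Rabs (f 0) + 1).
Proof.
intro H; apply ex_derive_continuous in H.
assert (L : locally 0 (fun x => Rabs (f x - f 0) < 1)).
{ apply (H (fun y => Rabs (y - f 0) < 1)).
  exists (mkposreal 1 Rlt_0_1); intros y hy; exact hy. }
revert L; apply filter_imp; intros x h.
assert (t := Rabs_triang (f x - f 0) (f 0)).
replace (f x - f 0 + f 0) with (f x) in t by ring; lra.
Qed.

Lemma locally_0_iff (P : R -> Prop) :
  locally 0 P <-> exists r, 0 < r /\ forall x, Rabs x < r -> P x.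
Proof.
split.
- intros [e He]; exists e; split; [apply cond_pos|].
  intros x hx; apply He; change (Rabs (x - 0) < e); now rewrite Rminus_0_r.
- intros [r [r0 Hr]]; exists (mkposreal r r0); intros x hx; apply Hr.
  change (Rabs (x - 0) < r) in hx; now rewrite Rminus_0_r in hx.
Qed.

Lemma Rabs_mult_le a b A B : Rabs a <= A -> Rabs b <= B -> Rabs (a * b) <= A * B.
Proof.
intros ha hb; rewrite Rabs_mult; apply Rmult_le_compat; auto using Rabs_pos.
Qed.

(** The difference of two solutions obeys a linear bound, since [F y - G t = F (y - t) + (F - G) t]
    and all functions are bounded near 0. *)
Lemma run_system_unique (y0 y1 y2 y3 t0 t1 t2 t3 : R -> R) :
  locally 0 (run_system y0 y1 y2 y3) -> locally 0 (run_system t0 t1 t2 t3) ->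
  y0 0 = t0 0 -> y1 0 = t1 0 -> y2 0 = t2 0 -> y3 0 = t3 0 ->
  locally 0 (fun x => y0 x = t0 x /\ y2 x = t2 x).
Proof.
intros Hy Ht e0 e1 e2 e3.
destruct (locally_singleton _ _ Hy) as [a0 [a1 [a2 a3]]].
destruct (locally_singleton _ _ Ht) as [b0 [b1 [b2 b3]]].
assert (E : forall (f : R -> R) (l : R), is_derive f 0 l -> ex_derive f 0) by (intros f l h; now exists l).
(* A single bound serves all eight functions near 0, as the two solutions share their initial
   values. *)
pose (M := Rabs (y0 0) + Rabs (y1 0) + Rabs (y2 0) + Rabs (y3 0) + 1).
assert (HM : forall f : R -> R, ex_derive f 0 -> Rabs (f 0) + 1 <= M ->
   locally 0 (fun x => Rabs (f x) <= M)).
{ intros f h hM; generalize (locally_bounded f h); apply filter_imp; intros; lra. }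
assert (q0 := Rabs_pos (y0 0)); assert (q1 := Rabs_pos (y1 0)).
assert (q2 := Rabs_pos (y2 0)); assert (q3 := Rabs_pos (y3 0)).
assert (B0 := HM _ (E _ _ a0) ltac:(unfold M; lra)).
assert (B1 := HM _ (E _ _ a1) ltac:(unfold M; lra)).
assert (B2 := HM _ (E _ _ a2) ltac:(unfold M; lra)).
assert (B3 := HM _ (E _ _ a3) ltac:(unfold M; lra)).
assert (C0 := HM _ (E _ _ b0) ltac:(rewrite <- e0; unfold M; lra)).
assert (C1 := HM _ (E _ _ b1) ltac:(rewrite <- e1; unfold M; lra)).
assert (C2 := HM _ (E _ _ b2) ltac:(rewrite <- e2; unfold M; lra)).
assert (C3 := HM _ (E _ _ b3) ltac:(rewrite <- e3; unfold M; lra)).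
assert (M0 : 0 <= M) by (unfold M; lra).
clearbody M. clear a0 a1 a2 a3 b0 b1 b2 b3 E HM q0 q1 q2 q3.
generalize (filter_and _ _ Hy (filter_and _ _ Ht
  (filter_and _ _ (filter_and _ _ B0 (filter_and _ _ B1 (filter_and _ _ B2 B3)))
     (filter_and _ _ C0 (filter_and _ _ C1 (filter_and _ _ C2 C3)))))).
clear - e0 e1 e2 e3 M0.
intro H; apply locally_0_iff in H; destruct H as [r [r0 H]].
apply locally_0_iff; exists r; split; [exact r0|]; intros x Hx.
pose (F := fun x => (y0 x + y1 x + y2 x + y3 x) / 2).
pose (G := fun x => (t0 x + t1 x + t2 x + t3 x) / 2).
(* With [S] the sum of the four distances, [|F| <= 2 M] and [|F - G| <= S / 2] bound the product
   terms by [5 M S / 2], and the odd-part terms add [S / 2]; [3 * M + 1] covers both. *)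
destruct (linear_ode_zero (fun x => y0 x - t0 x) (fun x => y1 x - t1 x)
  (fun x => y2 x - t2 x) (fun x => y3 x - t3 x)
  (fun x => F x * y0 x - G x * t0 x)
  (fun x => - F x * y1 x - - G x * t1 x)
  (fun x => (F x * y2 x + (y0 x - y1 x) / 2) - (G x * t2 x + (t0 x - t1 x) / 2))
  (fun x => (- F x * y3 x + (y0 x - y1 x) / 2) - (- G x * t3 x + (t0 x - t1 x) / 2))
  (3 * M + 1) r) with (x := x) as [h0 [_ [h2 _]]]; try lra.
clear x Hx; intros x Hx.
destruct (H x Hx) as [[a0 [a1 [a2 a3]]] [[b0 [b1 [b2 b3]]]
  [[B0 [B1 [B2 B3]]] [C0 [C1 [C2 C3]]]]]].
split.
{ split; [exact (is_derive_minus _ _ _ _ _ a0 b0)|].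
  split; [exact (is_derive_minus _ _ _ _ _ a1 b1)|].
  split; [exact (is_derive_minus _ _ _ _ _ a2 b2)|exact (is_derive_minus _ _ _ _ _ a3 b3)]. }
set (S := Rabs (y0 x - t0 x) + Rabs (y1 x - t1 x) + Rabs (y2 x - t2 x) + Rabs (y3 x - t3 x)).
assert (S0 : Rabs (y0 x - t0 x) <= S /\ Rabs (y1 x - t1 x) <= S /\
  Rabs (y2 x - t2 x) <= S /\ Rabs (y3 x - t3 x) <= S).
{ assert (q0 := Rabs_pos (y0 x - t0 x)); assert (q1 := Rabs_pos (y1 x - t1 x)).
  assert (q2 := Rabs_pos (y2 x - t2 x)); assert (q3 := Rabs_pos (y3 x - t3 x)).
  unfold S; lra. }
assert (HF : Rabs (F x) <= 2 * M).
{ unfold F; apply Rabs_le; apply Rabs_le_between in B0, B1, B2, B3; lra. }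
assert (T : forall z, - Rabs z <= z <= Rabs z).
{ intro z; split; [assert (h := Rabs_maj2 z); lra|apply Rle_abs]. }
assert (z0 := T (y0 x - t0 x)); assert (z1 := T (y1 x - t1 x)).
assert (z2 := T (y2 x - t2 x)); assert (z3 := T (y3 x - t3 x)).
assert (HG : Rabs (F x - G x) <= S / 2).
{ unfold F, G, S; apply Rabs_le; lra. }
assert (Hd : Rabs ((y0 x - t0 x - (y1 x - t1 x)) / 2) <= S / 2).
{ unfold S; apply Rabs_le; lra. }
assert (P : forall y t, Rabs (y - t) <= S -> Rabs t <= M ->
   Rabs (F x * (y - t)) <= 2 * M * S /\ Rabs ((F x - G x) * t) <= S / 2 * M).
{ intros y t h1 h2; split; apply Rabs_mult_le; assumption. }
destruct S0 as [s0 [s1 [s2 s3]]].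
assert (Sp : 0 <= S) by (apply Rle_trans with (2 := s0), Rabs_pos).
destruct (P _ _ s0 C0) as [u0 v0]; destruct (P _ _ s1 C1) as [u1 v1].
destruct (P _ _ s2 C2) as [u2 v2]; destruct (P _ _ s3 C3) as [u3 v3].
assert (MS : 0 <= M * S) by now apply Rmult_le_pos.
apply Rabs_le_between in u0, u1, u2, u3, v0, v1, v2, v3, Hd.
repeat split; apply Rabs_le; lra.
Qed.

Lemma euler_system_unique (p r P Q : R -> R) :
  locally 0 (euler_system p r) -> locally 0 (euler_system P Q) ->
  p 0 = P 0 -> r 0 = Q 0 -> locally 0 (fun x => p x = P x /\ r x = Q x).
Proof.
intros Hy Ht e0 e1.
destruct (locally_singleton _ _ Hy) as [a0 a1].
destruct (locally_singleton _ _ Ht) as [b0 b1].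
assert (E : forall (f : R -> R) (l : R), is_derive f 0 l -> ex_derive f 0) by (intros f l h; now exists l).
pose (M := Rabs (p 0) + Rabs (r 0) + 1).
assert (HM : forall f : R -> R, ex_derive f 0 -> Rabs (f 0) + 1 <= M ->
   locally 0 (fun x => Rabs (f x) <= M)).
{ intros f h hM; generalize (locally_bounded f h); apply filter_imp; intros; lra. }
assert (q0 := Rabs_pos (p 0)); assert (q1 := Rabs_pos (r 0)).
assert (B0 := HM _ (E _ _ a0) ltac:(unfold M; lra)).
assert (B1 := HM _ (E _ _ a1) ltac:(unfold M; lra)).
assert (C0 := HM _ (E _ _ b0) ltac:(rewrite <- e0; unfold M; lra)).
assert (C1 := HM _ (E _ _ b1) ltac:(rewrite <- e1; unfold M; lra)).
assert (M0 : 0 <= M) by (unfold M; lra).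
clearbody M. clear a0 a1 b0 b1 E HM q0 q1.
generalize (filter_and _ _ Hy (filter_and _ _ Ht
  (filter_and _ _ (filter_and _ _ B0 B1) (filter_and _ _ C0 C1)))).
clear - e0 e1 M0.
intro H; apply locally_0_iff in H; destruct H as [d [d0 H]].
apply locally_0_iff; exists d; split; [exact d0|]; intros x Hx.
(* Two zero functions pad the system to four. In each equation the halved square contributes [M]
   times one difference and the mixed product [M] times each difference, so [2 * M] suffices. *)
destruct (linear_ode_zero (fun x => p x - P x) (fun x => r x - Q x)
  (fun _ => 0) (fun _ => 0)
  (fun x => (r x ^ 2 - 2 * p x * r x) / 2 - (Q x ^ 2 - 2 * P x * Q x) / 2)
  (fun x => (1 + p x ^ 2 - 2 * p x * r x) / 2 - (1 + P x ^ 2 - 2 * P x * Q x) / 2)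
  (fun _ => 0) (fun _ => 0)
  (2 * M) d) with (x := x) as [h0 [h2 _]]; try lra.
clear x Hx; intros x Hx.
destruct (H x Hx) as [[a0 a1] [[b0 b1] [[B0 B1] [C0 C1]]]].
split.
{ split; [exact (is_derive_minus _ _ _ _ _ a0 b0)|].
  split; [exact (is_derive_minus _ _ _ _ _ a1 b1)|].
  split; exact (is_derive_const _ _). }
rewrite Rabs_R0.
set (S := Rabs (p x - P x) + Rabs (r x - Q x) + 0 + 0).
assert (K : forall z, Rabs z <= M -> Rabs (z * (p x - P x)) <= M * Rabs (p x - P x) /\
   Rabs (z * (r x - Q x)) <= M * Rabs (r x - Q x)).
{ intros z h; split; apply Rabs_mult_le; auto using Rle_refl. }
assert (MS : 0 <= M * Rabs (p x - P x) /\ 0 <= M * Rabs (r x - Q x)).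
{ split; apply Rmult_le_pos; auto using Rabs_pos. }
destruct (K _ B0) as [u0 v0]; destruct (K _ B1) as [u1 v1].
destruct (K _ C0) as [u2 v2]; destruct (K _ C1) as [u3 v3].
apply Rabs_le_between in u0, u1, u2, u3, v0, v1, v2, v3.
unfold S.
repeat split; [apply Rabs_le; lra|apply Rabs_le; lra|lra|lra].
Qed.

(** * Explicit solutions of the two systems *)

Local Notation c x := (cos (x / 2)).
Local Notation s x := (sin (x / 2)).
Local Notation Ch x := (cosh (sqrt 3 * x / 2)).
Local Notation Sh x := (sinh (sqrt 3 * x / 2)).

Lemma sqrt3_sqr : sqrt 3 * sqrt 3 = 3.
Proof. apply sqrt_sqrt; lra. Qed.

Lemma cos2_half x : c x * c x = 1 - s x * s x.
Proof. assert (h := sin2_cos2 (x / 2)); unfold Rsqr in h; lra. Qed.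

Lemma cosh2 x : cosh x * cosh x = 1 + sinh x * sinh x.
Proof.
unfold cosh, sinh.
assert (e : exp x * exp (- x) = 1) by (rewrite <- exp_plus, Rplus_opp_r; apply exp_0).
nra.
Qed.

(** All numerators and denominators of the closed forms lie in the span of these four functions,
    which differentiation preserves. The closed forms below spell out zero coefficients so that this
    lemma unifies with them. *)
Lemma is_derive_lin (a b d e x : R) :
  is_derive (fun x => a * c x + b * s x + d * Ch x + e * Sh x) x
    ((b * c x - a * s x + e * sqrt 3 * Ch x + d * sqrt 3 * Sh x) / 2).
Proof. unfold cosh, sinh, Rdiv; auto_derive; [exact I|]; field. Qed.

Lemma is_derive_quot (f g : R -> R) (df dg x l : R) :
  is_derive f x df -> is_derive g x dg -> g x <> 0 ->
  (df * g x - f x * dg) / g x ^ 2 = l -> is_derive (fun x => f x / g x) x l.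
Proof. intros hf hg hx <-; exact (is_derive_div f g x df dg hf hg hx). Qed.

Lemma locally_lin_neq0 (a b d e : R) : a + d <> 0 ->
  locally 0 (fun x => a * c x + b * s x + d * Ch x + e * Sh x <> 0).
Proof.
intro h.
set (f := fun x => a * c x + b * s x + d * Ch x + e * Sh x).
assert (cf : continuous f 0).
{ apply (ex_derive_continuous f); eexists; apply is_derive_lin. }
apply (cf (fun y => y <> 0)).
assert (f0 : f 0 = a + d).
{ unfold f; rewrite Rdiv_0_l, Rmult_0_r, Rdiv_0_l, cos_0, sin_0, sinh_0, cosh_0; ring. }
rewrite f0; exact (open_neq 0 (a + d) h).
Qed.

(** The functions come in pairs exchanged by the reflection of [x] to [- x]. The first is 1 plus the
    closed form for the numbers [cnum]. *)
Lemma run_system_closed_form :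
  locally 0 (run_system
    (fun x => (3 * c x + 0 * s x + 0 * Ch x + sqrt 3 * Sh x) /
              (3 * c x + 0 * s x + 0 * Ch x + - sqrt 3 * Sh x))
    (fun x => (3 * c x + 0 * s x + 0 * Ch x + - sqrt 3 * Sh x) /
              (3 * c x + 0 * s x + 0 * Ch x + sqrt 3 * Sh x))
    (fun x => (-3 * c x + 3 * s x + 3 * Ch x + - sqrt 3 * Sh x) /
              (3 * c x + 0 * s x + 0 * Ch x + - sqrt 3 * Sh x))
    (fun x => (-3 * c x + -3 * s x + 3 * Ch x + sqrt 3 * Sh x) /
              (3 * c x + 0 * s x + 0 * Ch x + sqrt 3 * Sh x))).
Proof.
assert (h30 : 3 + 0 <> 0) by lra.
generalize (filter_and _ _ (locally_lin_neq0 3 0 0 (sqrt 3) h30)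
  (locally_lin_neq0 3 0 0 (- sqrt 3) h30)).
apply filter_imp; intros x [hP hD].
assert (k2 := sqrt3_sqr); assert (c2 := cos2_half x); assert (C2 := cosh2 (sqrt 3 * x / 2)).
split; [|split; [|split]]; (eapply is_derive_quot; [apply is_derive_lin|apply is_derive_lin|assumption|]);
  revert hP hD k2 c2 C2;
  (* Apart from nonvanishing denominators, what is left is a polynomial identity modulo [k^2 = 3],
     [X^2 = 1 - Y^2] and [U^2 = 1 + V^2]. *)
  generalize (sqrt 3) (c x) (s x) (Ch x) (Sh x); intros k X Y U V hP hD k2 c2 C2;
  field_simplify_eq [k2 c2 C2]; try (split; lra); try ring [k2 c2 C2].
Qed.

Lemma euler_system_closed_form :
  locally 0 (euler_system
    (fun x => (3 * c x + 0 * s x + 0 * Ch x + sqrt 3 * Sh x) /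
              (0 * c x + 3 * s x + 3 * Ch x + 0 * Sh x))
    (fun x => (0 * c x + 0 * s x + 0 * Ch x + 2 * sqrt 3 * Sh x) /
              (0 * c x + 3 * s x + 3 * Ch x + 0 * Sh x))).
Proof.
assert (h03 : 0 + 3 <> 0) by lra.
generalize (locally_lin_neq0 0 3 3 0 h03).
apply filter_imp; intros x hD.
assert (k2 := sqrt3_sqr); assert (c2 := cos2_half x); assert (C2 := cosh2 (sqrt 3 * x / 2)).
split; (eapply is_derive_quot; [apply is_derive_lin|apply is_derive_lin|assumption|]);
  revert hD k2 c2 C2;
  generalize (sqrt 3) (c x) (s x) (Ch x) (Sh x); intros k X Y U V hD k2 c2 C2;
  field_simplify_eq [k2 c2 C2]; try (intro h; apply hD; lra); try ring [k2 c2 C2].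
Qed.

(** * The generating functions of good permutations *)

Lemma CV_radius_ge (a : nat -> R) (r M : R) :
  (forall n, Rabs (a n * r ^ n) <= M) -> Rbar_le r (CV_radius a).
Proof. intro H; apply (proj1 (CV_radius_bounded a)); now exists M. Qed.

(* Retypes an equality between elements of the normed module R as one in R,
   which [ring] and [field] insist on. *)
Ltac real_eq := match goal with |- ?a = ?b => change (@eq R a b) end.

Lemma locally_lt_radius (r : R) : 0 < r -> locally 0 (fun x => Rabs x < r).
Proof. intro h; apply locally_0_iff; now exists r. Qed.

Lemma is_series_PSeries (a : nat -> R) (x : R) :
  Rbar_lt (Rabs x) (CV_radius a) -> is_series (fun n => a n * x ^ n) (PSeries a x).
Proof. intro h; exact (proj1 (is_pseries_R _ _ _) (PSeries_correct _ _ (CV_radius_inside _ _ h))). Qed.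

Lemma pow_opp_odd (x : R) n : (- x) ^ n = if ssrnat.odd n then - x ^ n else x ^ n.
Proof.
induction n as [|n IH]; [reflexivity|].
simpl; rewrite IH; destruct (ssrnat.odd n); simpl; ring.
Qed.

Lemma PSeries_even_part (a : nat -> R) x : Rbar_lt (Rabs x) (CV_radius a) ->
  PSeries (fun n => if ssrnat.odd n then 0 else a n) x = (PSeries a x + PSeries a (- x)) / 2.
Proof.
intro h; apply is_pseries_unique, is_pseries_R.
assert (h' : Rbar_lt (Rabs (- x)) (CV_radius a)) by now rewrite Rabs_Ropp.
assert (H := is_series_scal (/ 2) _ _
  (is_series_plus _ _ _ _ (is_series_PSeries a x h) (is_series_PSeries a (- x) h'))).
replace ((PSeries a x + PSeries a (- x)) / 2) with (/ 2 * (PSeries a x + PSeries a (- x))) by field.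
apply is_series_ext with (2 := H); intro n.
change (/ 2 * (a n * x ^ n + a n * (- x) ^ n) = (if ssrnat.odd n then 0 else a n) * x ^ n).
rewrite pow_opp_odd; destruct (ssrnat.odd n); field.
Qed.

Lemma PSeries_odd_part (a : nat -> R) x : Rbar_lt (Rabs x) (CV_radius a) ->
  PSeries (fun n => if ssrnat.odd n then a n else 0) x = (PSeries a x - PSeries a (- x)) / 2.
Proof.
intro h; apply is_pseries_unique, is_pseries_R.
assert (h' : Rbar_lt (Rabs (- x)) (CV_radius a)) by now rewrite Rabs_Ropp.
assert (H := is_series_scal (/ 2) _ _
  (is_series_minus _ _ _ _ (is_series_PSeries a x h) (is_series_PSeries a (- x) h'))).
replace ((PSeries a x - PSeries a (- x)) / 2) with (/ 2 * (PSeries a x - PSeries a (- x))) by field.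
apply is_series_ext with (2 := H); intro n.
change (/ 2 * (a n * x ^ n - a n * (- x) ^ n) = (if ssrnat.odd n then a n else 0) * x ^ n).
rewrite pow_opp_odd; destruct (ssrnat.odd n); field.
Qed.

Section RunSeries.
Local Notation w1 := (Combinatorics.weight 1).
Local Notation w2 := (Combinatorics.weight 2).
(** The coefficients of [F]; those of the odd part of [u] follow. *)
Let even_weight (n : nat) := if ssrnat.odd n then 0 else w1 n + w2 n.
Let odd_weight (n : nat) := if ssrnat.odd n then w1 n else 0.

Let radius_gt (a : nat -> R) (x : R) :
  (forall n, Rabs (a n) <= 2) -> Rabs x < 1 -> Rbar_lt (Rabs x) (CV_radius a).
Proof.
intros H hx; apply Rbar_lt_le_trans with 1; [exact hx|].
apply CV_radius_ge with 2; intro n; rewrite pow1, Rmult_1_r; apply H.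
Qed.

Let weight_le k n : Rabs (Combinatorics.weight k n) <= 1.
Proof. destruct (Combinatorics.weight_bounds k n); apply Rabs_le; lra. Qed.

Let even_weight_le n : Rabs (even_weight n) <= 2.
Proof.
unfold even_weight; destruct (ssrnat.odd n); [rewrite Rabs_R0; lra|].
eapply Rle_trans; [apply Rabs_triang|].
assert (h1 := weight_le 1 n); assert (h2 := weight_le 2 n); lra.
Qed.

Let odd_weight_le n : Rabs (odd_weight n) <= 2.
Proof.
unfold odd_weight; destruct (ssrnat.odd n); [|rewrite Rabs_R0; lra].
assert (h1 := weight_le 1 n); lra.
Qed.

Let weight_le2 k n : Rabs (Combinatorics.weight k n) <= 2.
Proof. assert (h := weight_le k n); lra. Qed.

Lemma PSeries_even_weight x : Rabs x < 1 ->
  PSeries even_weight x = (PSeries w1 x + PSeries w1 (- x) + PSeries w2 x + PSeries w2 (- x)) / 2.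
Proof.
intro hx; assert (hx' : Rabs (- x) < 1) by now rewrite Rabs_Ropp.
assert (h1 := radius_gt w1 x (weight_le2 1) hx); assert (h2 := radius_gt w2 x (weight_le2 2) hx).
assert (h1' := radius_gt w1 _ (weight_le2 1) hx'); assert (h2' := radius_gt w2 _ (weight_le2 2) hx').
unfold even_weight; rewrite (PSeries_even_part (PS_plus w1 w2)).
- rewrite !PSeries_plus; try apply CV_radius_inside; try assumption; lra.
- apply radius_gt; [|exact hx]; intro n.
  eapply Rle_trans; [apply Rabs_triang|].
  assert (t1 := weight_le 1 n); assert (t2 := weight_le 2 n); lra.
Qed.

Lemma is_derive_PSeries_weight1 x : Rabs x < 1 ->
  is_derive (PSeries w1) x (PSeries even_weight x * PSeries w1 x).
Proof.
intro hx; assert (h1 := radius_gt w1 x (weight_le2 1) hx).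
assert (he := radius_gt even_weight x even_weight_le hx).
rewrite <- PSeries_mult by assumption.
rewrite <- (PSeries_ext (PS_derive w1)); [now apply is_derive_PSeries|].
intro n; apply Combinatorics.weight1_succ.
Qed.

Lemma is_derive_PSeries_weight2 x : Rabs x < 1 ->
  is_derive (PSeries w2) x (PSeries even_weight x * PSeries w2 x + (PSeries w1 x - PSeries w1 (- x)) / 2).
Proof.
intro hx; assert (h1 := radius_gt w1 x (weight_le2 1) hx).
assert (h2 := radius_gt w2 x (weight_le2 2) hx).
assert (he := radius_gt even_weight x even_weight_le hx).
assert (ho := radius_gt odd_weight x odd_weight_le hx).
rewrite <- PSeries_mult, <- PSeries_odd_part by assumption.
change (fun n => if ssrnat.odd n then w1 n else 0) with odd_weight.
rewrite <- PSeries_plus;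
  [|now apply ex_pseries_mult|now apply CV_radius_inside].
rewrite <- (PSeries_ext (PS_derive w2)); [now apply is_derive_PSeries|].
intro n; apply Combinatorics.weight2_succ.
Qed.

Lemma is_derive_comp_opp (f : R -> R) (x l : R) :
  is_derive f (- x) l -> is_derive (fun x => f (- x)) x (- l).
Proof.
intro h; replace (- l) with (scal (-1) l) by (unfold scal; simpl; unfold mult; simpl; ring).
apply (is_derive_comp f (fun x => - x) x l (-1)); [exact h|].
auto_derive; [exact I|ring].
Qed.

Lemma run_system_PSeries : locally 0 (run_system (PSeries w1) (fun x => PSeries w1 (- x))
  (PSeries w2) (fun x => PSeries w2 (- x))).
Proof.
apply locally_0_iff; exists 1; split; [lra|]; intros x hx.
assert (hx' : Rabs (- x) < 1) by now rewrite Rabs_Ropp.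
unfold run_system; rewrite <- PSeries_even_weight by exact hx.
(* [F] is even, so the equations taken at [- x] become those of the reflected functions, with the
   sign of [F] reversed. *)
assert (E : PSeries even_weight x = PSeries even_weight (- x)).
{ rewrite !PSeries_even_weight, Ropp_involutive by assumption; field. }
split; [now apply is_derive_PSeries_weight1|].
split; [|split; [now apply is_derive_PSeries_weight2|]].
- rewrite Ropp_mult_distr_l_reverse, E.
  now apply is_derive_comp_opp, is_derive_PSeries_weight1.
- replace (- PSeries even_weight x * PSeries w2 (- x) + (PSeries w1 x - PSeries w1 (- x)) / 2)
    with (- (PSeries even_weight (- x) * PSeries w2 (- x)
             + (PSeries w1 (- x) - PSeries w1 (- - x)) / 2))
    by (rewrite E, Ropp_involutive; field).
  now apply is_derive_comp_opp, is_derive_PSeries_weight2.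
Qed.

Lemma run_series :
  locally 0 (fun x =>
    is_series (fun n => INR (cnum n) * x ^ n / INR (fact n))
      (2 * sqrt 3 * Sh x / (3 * c x - sqrt 3 * Sh x)) /\
    is_series (fun n => INR (dnum n) * x ^ n / INR (fact n))
      ((3 * s x - 3 * c x + 3 * Ch x - sqrt 3 * Sh x) / (3 * c x - sqrt 3 * Sh x)) /\
    3 * c x - sqrt 3 * Sh x <> 0).
Proof.
assert (h30 : 3 + 0 <> 0) by lra.
assert (U := run_system_unique _ _ _ _ _ _ _ _ run_system_PSeries run_system_closed_form).
(* Both solutions start from [1, 1, 0, 0], so the four initial conditions become numerical. *)
cbv beta in U; rewrite Ropp_0, Rdiv_0_l, Rmult_0_r, Rdiv_0_l, cos_0, sin_0, sinh_0, cosh_0, !PSeries_0,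
  !Combinatorics.weight_0 in U; simpl in U.
generalize (filter_and _ _ (locally_lin_neq0 3 0 0 (- sqrt 3) h30)
  (filter_and _ _ (locally_lt_radius 1 Rlt_0_1)
    (U ltac:(field) ltac:(field) ltac:(field) ltac:(field)))).
apply filter_imp; intros x [hD [hx [e1 e2]]].
assert (hD' : 3 * c x - sqrt 3 * Sh x <> 0) by (intro h; apply hD; lra).
assert (S1 := is_series_PSeries w1 x (radius_gt w1 x (weight_le2 1) hx)).
assert (S2 := is_series_PSeries w2 x (radius_gt w2 x (weight_le2 2) hx)).
split; [|split; [|exact hD']].
(* The weight at index 0 is 1 but [cnum 0] is 0: the first term is split off and the sum drops by
   1. *)
- apply is_series_decr_1.
  apply is_series_ext with (fun n => w1 (S n) * x ^ S n).
  { intro n; rewrite <- Combinatorics.weight_cnum; unfold Rdiv; real_eq; ring. }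
  apply (is_series_incr_1 (fun n => w1 n * x ^ n)).
  match goal with |- is_series _ ?l => replace l with (PSeries w1 x); [exact S1|] end.
  rewrite e1, Combinatorics.weight_0; unfold plus, opp; simpl.
  real_eq; field.
  exact hD'.
- apply is_series_ext with (fun n => w2 n * x ^ n).
  { intro n; rewrite <- Combinatorics.weight_dnum; unfold Rdiv; real_eq; ring. }
  match goal with |- is_series _ ?l => replace l with (PSeries w2 x); [exact S2|] end.
  rewrite e2; field; exact hD'.
Qed.
End RunSeries.

(** * The trisected series of sec + tan *)

Lemma is_series_bounded (a : nat -> R) l : is_series a l ->
  exists M, forall n, Rabs (a n) <= M.
Proof.
intro H; assert (L := ex_series_lim_0 a (ex_intro _ l H)).
assert (L' : exists y : R, filterlim a eventually (locally y)) by (exists 0; exact L).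
destruct (filterlim_bounded a L') as [M HM]; exists M; exact HM.
Qed.

(** Convergence at [r / 2] bounds the terms there. Losing a factor 2 is harmless, as only the
    behaviour near 0 counts. *)
Lemma CV_radius_ge_of_series (a : nat -> R) (f : R -> R) (r : R) : 0 < r ->
  (forall x, Rabs x < r -> is_series (fun n => a n * x ^ n) (f x)) ->
  Rbar_le (r / 2) (CV_radius a).
Proof.
intros r0 H.
assert (h : Rabs (r / 2) < r) by (rewrite Rabs_right; lra).
destruct (is_series_bounded _ _ (H _ h)) as [M HM].
apply CV_radius_ge with M; exact HM.
Qed.

Lemma is_derive_sec_tan x : cos x <> 0 ->
  is_derive (fun x => 1 / cos x + tan x) x ((1 + (1 / cos x + tan x) ^ 2) / 2).
Proof.
intro h; unfold tan; auto_derive; [now repeat split|].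
assert (h1 := sin2_cos2 x); unfold Rsqr in h1.
assert (h2 : cos x * cos x = 1 - sin x * sin x) by lra.
field_simplify_eq; [|exact h]; ring [h2].
Qed.

Lemma locally_cos_neq0 : locally 0 (fun x => cos x <> 0).
Proof.
assert (cf : continuous cos 0).
{ apply (ex_derive_continuous cos); exists (- sin 0); auto_derive; [exact I|ring]. }
apply (cf (fun y => y <> 0)); rewrite cos_0; exact (open_neq 0 1 R1_neq_R0).
Qed.

(* Coordinates of w^n in the basis (1, w), for w a primitive cube root of unity. *)
Fixpoint omega_pow (n : nat) : R * R :=
  match n with
  | O => (1, 0)
  | S m => (- snd (omega_pow m), fst (omega_pow m) - snd (omega_pow m))
  end.

Local Notation re_omega n := (fst (omega_pow n)).
Local Notation im_omega n := (snd (omega_pow n)).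

(** Multiplication in the basis [1, w], reduced by [w^2 = - 1 - w]. *)
Lemma omega_pow_add i j :
  re_omega (i + j) = re_omega i * re_omega j - im_omega i * im_omega j /\
  im_omega (i + j) = re_omega i * im_omega j + im_omega i * re_omega j - im_omega i * im_omega j.
Proof.
induction i as [|i [IH1 IH2]]; simpl; [split; ring|].
rewrite IH1, IH2; split; ring.
Qed.

Lemma omega_pow_add3 n : omega_pow (S (S (S n))) = omega_pow n.
Proof. simpl; destruct (omega_pow n); simpl; f_equal; ring. Qed.

Lemma omega_pow_3n n : omega_pow (3 * n) = (1, 0).
Proof.
induction n as [|n IH]; [reflexivity|].
replace (3 * S n)%nat with (S (S (S (3 * n)))) by lia.
now rewrite omega_pow_add3.
Qed.

Lemma omega_pow_le n : Rabs (re_omega n) <= 1 /\ Rabs (im_omega n) <= 1.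
Proof.
assert (H : omega_pow n = (1, 0) \/ omega_pow n = (0, 1) \/ omega_pow n = (-1, -1)).
{ induction n as [|n IH]; [now left|].
  simpl; destruct IH as [-> | [-> | ->]]; simpl.
  - right; left; f_equal; ring.
  - right; right; f_equal; ring.
  - left; f_equal; ring. }
destruct H as [-> | [-> | ->]]; simpl; split; apply Rabs_le; lra.
Qed.

(** The grouped partial sums are the original ones at the indices [3 * n + 2], a subsequence. *)
Lemma infinite_sum_group3 (a : nat -> R) l : is_series a l ->
  infinite_sum (fun n => a (3 * n)%nat + a (3 * n + 1)%nat + a (3 * n + 2)%nat) l.
Proof.
intro H; apply is_series_Reals in H.
intros e he; destruct (H e he) as [N HN]; exists N; intros n hn.
replace (sum_f_R0 _ n) with (sum_f_R0 a (3 * n + 2)); [apply HN; lia|].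
clear; induction n as [|n IH]; [simpl; ring|].
rewrite tech5, <- IH.
replace (3 * S n + 2)%nat with (S (S (S (3 * n + 2)))) by lia.
rewrite !tech5, !Rplus_assoc.
replace (S (3 * n + 2)) with (3 * S n)%nat by lia.
replace (S (3 * S n)) with (3 * S n + 1)%nat by lia.
now replace (S (3 * S n + 1)) with (3 * S n + 2)%nat by lia.
Qed.

Definition PS_one (n : nat) : R := match n with O => 1 | _ => 0 end.

Lemma is_series_PS_one (x : R) : is_series (fun n => PS_one n * x ^ n) 1.
Proof.
apply is_series_decr_1.
replace (plus _ _) with (0 : R) by (unfold plus, opp; simpl; ring).
apply is_series_Reals; intros d hd; exists O; intros m _.
rewrite (sum_eq_R0 _ m); [now rewrite R_dist_eq|].
intros k _; simpl; ring.
Qed.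

Section EulerSeries.
Variables (e : nat -> R) (r : R).
Hypothesis r_gt0 : 0 < r.
Hypothesis series_e :
  forall x, Rabs x < r -> is_series (fun n => e n * x ^ n) (1 / cos x + tan x).

Let re_part (n : nat) := re_omega n * e n.
Let im_part (n : nat) := im_omega n * e n.

(** Coefficients are compared in [2 f' = 1 + f^2]: both sides have positive radius and agree near
    0. *)
Lemma sec_tan_rec n :
  2 * (INR (S n) * e (S n)) = PS_one n + PS_mult e e n.
Proof.
assert (R0 := CV_radius_ge_of_series e _ r r_gt0 series_e).
assert (R1 : Rbar_lt 0 (CV_radius e)).
{ apply Rbar_lt_le_trans with (2 := R0); simpl; lra. }

pose (lhs := PS_scal 2 (PS_derive e)); pose (rhs := PS_plus PS_one (PS_mult e e)).
change (lhs n = rhs n).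
assert (Rone : Rbar_lt 0 (CV_radius PS_one)).
{ apply Rbar_lt_le_trans with (r / 2); [simpl; lra|].
  apply (CV_radius_ge_of_series PS_one (fun _ => 1) r r_gt0); intros; apply is_series_PS_one. }
assert (Rsq : Rbar_lt 0 (CV_radius (PS_mult e e))).
(* Halved twice: the square is known to converge for [Rabs x < r / 2], and the criterion halves once
   more. *)
{ apply Rbar_lt_le_trans with (r / 2 / 2); [simpl; lra|].
  apply (CV_radius_ge_of_series _ (PSeries (PS_mult e e))); [lra|]; intros x hx.
  assert (hx1 : Rbar_lt (Rabs x) (CV_radius e)) by now apply Rbar_lt_le_trans with (2 := R0).
  exact (proj1 (is_pseries_R _ _ _) (PSeries_correct _ _ (ex_pseries_mult _ _ _ hx1 hx1))). }
assert (Rlhs : CV_radius lhs = CV_radius e).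
{ unfold lhs; rewrite CV_radius_scal by lra; apply CV_radius_derive. }
assert (Rrhs : Rbar_lt 0 (CV_radius rhs)).
{ eapply Rbar_lt_le_trans; [|apply CV_radius_plus].
  now apply Rbar_min_case. }
apply PSeries_ext_recip; [now rewrite Rlhs|exact Rrhs|].
assert (r2 : 0 < r / 2) by lra.
generalize (filter_and _ _ (locally_lt_radius (r / 2) r2) locally_cos_neq0).
apply filter_imp; intros x [hx hc].
assert (hx1 : Rbar_lt (Rabs x) (CV_radius e)) by now apply Rbar_lt_le_trans with (2 := R0).
assert (Ee : forall y, Rabs y < r -> PSeries e y = 1 / cos y + tan y).
{ intros y hy; apply is_pseries_unique, is_pseries_R, series_e, hy. }
assert (D : PSeries (PS_derive e) x = (1 + PSeries e x ^ 2) / 2).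
{ rewrite <- (is_derive_unique _ _ _ (is_derive_PSeries e x hx1)), Ee by lra.
  rewrite <- (is_derive_unique _ _ _ (is_derive_sec_tan x hc)).
  (* The series equals [sec + tan] on the whole ball of radius [r - Rabs x] around [x], hence the
     derivatives at [x] agree. *)
  apply Derive_ext_loc.
  assert (d0 : 0 < r - Rabs x) by lra.
  exists (mkposreal _ d0); intros y hy; apply Ee.
  change (Rabs (y - x) < r - Rabs x) in hy.
  assert (t := Rabs_triang (y - x) x); replace (y - x + x) with y in t by lra; lra. }
assert (P1 : is_pseries PS_one x 1) by (apply is_pseries_R, is_series_PS_one).
unfold lhs, rhs; rewrite PSeries_scal, D.
rewrite (PSeries_plus _ _ _ (ex_intro _ _ P1) (ex_pseries_mult _ _ _ hx1 hx1)).
rewrite (PSeries_mult _ _ _ hx1 hx1), (is_pseries_unique _ _ _ P1); real_eq; field.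
Qed.

Lemma sec_tan_0 : e 0%nat = 1.
Proof.
assert (h : Rabs 0 < r) by (rewrite Rabs_R0; exact r_gt0).
rewrite <- (PSeries_0 e).
rewrite (is_pseries_unique e 0 (1 / cos 0 + tan 0)) by now apply is_pseries_R, series_e.
rewrite cos_0, tan_0; field.
Qed.

Let radius_parts x : Rabs x < r / 2 ->
  Rbar_lt (Rabs x) (CV_radius re_part) /\ Rbar_lt (Rabs x) (CV_radius im_part).
Proof.
intro hx.
assert (h : Rabs (r / 2) < r) by (rewrite Rabs_right; lra).
destruct (is_series_bounded _ _ (series_e _ h)) as [M HM].
split; (apply Rbar_lt_le_trans with (r / 2); [exact hx|]);
  apply CV_radius_ge with M; intro n;
  destruct (omega_pow_le n) as [h1 h2]; unfold re_part, im_part;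
  rewrite Rmult_assoc, <- (Rmult_1_l M); apply Rabs_mult_le; auto; apply HM.
Qed.

(** The derivative of [F(w x)] is [w F'(w x)], and [w (p + w r)^2 = (r^2 - 2 p r) + w (p^2 - 2 p
    r)]. The two coordinates give this recurrence and the next; the constant 1, multiplied by [w],
    appears only in the next. *)
Lemma re_part_rec n : PS_derive re_part n =
  (PS_mult im_part im_part n - PS_mult re_part im_part n - PS_mult im_part re_part n) / 2.
Proof.
assert (H := sec_tan_rec n); unfold PS_derive, re_part at 1.
assert (T : re_omega (S n) * PS_mult e e n =
  PS_mult im_part im_part n - PS_mult re_part im_part n - PS_mult im_part re_part n).
{ unfold PS_mult; rewrite scal_sum, <- !minus_sum; apply PartSum.sum_eq; intros i hi.
  (* The unit beyond [i + (n - i)] is the factor [w] from the chain rule. *)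
  replace (S n) with (S (i + (n - i))) by lia.
  simpl; rewrite (proj2 (omega_pow_add i (n - i))); unfold re_part, im_part; ring. }
(* At [n = 0] the constant 1 meets the first coordinate of [w], which is 0. *)
unfold PS_one in H; destruct n as [|n]; [|rewrite <- T; nra].
rewrite <- T; simpl in *; nra.
Qed.

Lemma im_part_rec n : PS_derive im_part n = (PS_one n +
  PS_mult re_part re_part n - PS_mult re_part im_part n - PS_mult im_part re_part n) / 2.
Proof.
assert (H := sec_tan_rec n); unfold PS_derive, im_part at 1.
assert (T : im_omega (S n) * PS_mult e e n =
  PS_mult re_part re_part n - PS_mult re_part im_part n - PS_mult im_part re_part n).
{ unfold PS_mult; rewrite scal_sum, <- !minus_sum; apply PartSum.sum_eq; intros i hi.
  replace (S n) with (S (i + (n - i))) by lia.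
  simpl; rewrite (proj2 (omega_pow_add i (n - i))), (proj1 (omega_pow_add i (n - i)));
    unfold re_part, im_part; ring. }
unfold PS_one in *; destruct n as [|n]; [simpl in *; nra|nra].
Qed.

Lemma euler_system_PSeries : locally 0 (euler_system (PSeries re_part) (PSeries im_part)).
Proof.
apply locally_0_iff; exists (r / 2); split; [lra|]; intros x hx.
destruct (radius_parts x hx) as [h1 h2].
assert (m11 := ex_pseries_mult _ _ _ h1 h1); assert (m12 := ex_pseries_mult _ _ _ h1 h2).
assert (m21 := ex_pseries_mult _ _ _ h2 h1); assert (m22 := ex_pseries_mult _ _ _ h2 h2).
assert (m1 := ex_intro _ _ (proj2 (is_pseries_R _ _ _) (is_series_PS_one x)) : ex_pseries PS_one x).
split.
- replace ((PSeries im_part x ^ 2 - 2 * PSeries re_part x * PSeries im_part x) / 2)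
    with (PSeries (PS_derive re_part) x); [now apply is_derive_PSeries|].
  rewrite (PSeries_ext _ (PS_scal (/ 2) (PS_minus (PS_minus
    (PS_mult im_part im_part) (PS_mult re_part im_part)) (PS_mult im_part re_part)))).
  2: { intro n; rewrite re_part_rec; unfold PS_scal, PS_minus, PS_plus, PS_opp,
         scal, plus, opp; simpl; unfold mult; simpl; field. }
  rewrite PSeries_scal.
  rewrite (PSeries_minus _ _ _ (ex_pseries_minus _ _ _ m22 m12) m21).
  rewrite (PSeries_minus _ _ _ m22 m12), !PSeries_mult by assumption; field.
- replace ((1 + PSeries re_part x ^ 2 - 2 * PSeries re_part x * PSeries im_part x) / 2)
    with (PSeries (PS_derive im_part) x); [now apply is_derive_PSeries|].
  rewrite (PSeries_ext _ (PS_scal (/ 2) (PS_minus (PS_minus (PS_plus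
    PS_one
    (PS_mult re_part re_part)) (PS_mult re_part im_part)) (PS_mult im_part re_part)))).
  2: { intro n; rewrite im_part_rec; unfold PS_scal, PS_minus, PS_plus, PS_opp,
         scal, plus, opp; simpl; unfold mult; simpl; field. }
  rewrite PSeries_scal.
  rewrite (PSeries_minus _ _ _ (ex_pseries_minus _ _ _ (ex_pseries_plus _ _ _ m1 m11) m12) m21).
  rewrite (PSeries_minus _ _ _ (ex_pseries_plus _ _ _ m1 m11) m12).
  rewrite (PSeries_plus _ _ _ m1 m11), !PSeries_mult by assumption.
  rewrite (is_pseries_unique _ _ _ (proj2 (is_pseries_R _ _ _) (is_series_PS_one x))); real_eq; field.
Qed.

(** Let [A0, A1, A2] be the parts of the series by exponent mod 3. Then [p = A0 - A2] and
    [r = A1 - A2], so the three sums are [p - r], [r] and [1 - p], where 1 is the term [e 0] missing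
    from the shifted third sum. *)
Lemma euler_series : locally 0 (fun x =>
  let d := 3 * Ch x + 3 * s x in
  d <> 0 /\
  infinite_sum (fun n => e (3 * n)%nat * x ^ (3 * n) - e (3 * n + 1)%nat * x ^ (3 * n + 1))
    ((3 * c x - sqrt 3 * Sh x) / d) /\
  infinite_sum (fun n => e (3 * n + 1)%nat * x ^ (3 * n + 1) - e (3 * n + 2)%nat * x ^ (3 * n + 2))
    (2 * sqrt 3 * Sh x / d) /\
  infinite_sum (fun n => e (3 * n + 2)%nat * x ^ (3 * n + 2) - e (3 * n + 3)%nat * x ^ (3 * n + 3))
    ((3 * s x - 3 * c x + 3 * Ch x - sqrt 3 * Sh x) / d)).
Proof.
assert (h03 : 0 + 3 <> 0) by lra.
assert (r2 : 0 < r / 2) by lra.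
assert (U := euler_system_unique _ _ _ _ euler_system_PSeries euler_system_closed_form).
cbv beta in U; rewrite Rdiv_0_l, Rmult_0_r, Rdiv_0_l, cos_0, sin_0, sinh_0, cosh_0, !PSeries_0 in U.
unfold re_part at 1, im_part at 1 in U; simpl in U; rewrite sec_tan_0 in U.
generalize (filter_and _ _ (locally_lin_neq0 0 3 3 0 h03)
  (filter_and _ _ (locally_lt_radius (r / 2) r2) (U ltac:(field) ltac:(field)))).
apply filter_imp; intros x [hD [hx [e1 e2]]].
assert (hd : 3 * Ch x + 3 * s x <> 0) by (intro h; apply hD; lra).
destruct (radius_parts x hx) as [h1 h2].
assert (S1 := is_series_PSeries _ _ h1); assert (S2 := is_series_PSeries _ _ h2).
assert (O1 : forall n, omega_pow (3 * n + 1) = (0, 1)).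
{ intro n; replace (3 * n + 1)%nat with (S (3 * n)) by lia; cbn [omega_pow].
  rewrite omega_pow_3n; simpl; f_equal; ring. }
assert (O2 : forall n, omega_pow (3 * n + 2) = (-1, -1)).
{ intro n; replace (3 * n + 2)%nat with (S (3 * n + 1)) by lia; cbn [omega_pow].
  rewrite O1; simpl; f_equal; ring. }
split; [exact hd|split; [|split]].
- assert (G := infinite_sum_group3 _ _ (is_series_minus _ _ _ _ S1 S2)).
  replace ((3 * c x - sqrt 3 * Sh x) / (3 * Ch x + 3 * s x)) with (PSeries re_part x - PSeries im_part x)
    by (rewrite e1, e2; real_eq; field; exact hd).
  apply is_series_Reals; apply is_series_Reals in G; revert G; apply is_series_ext; intro n.
  unfold plus, opp, re_part, im_part; simpl plus; simpl opp; rewrite O1, O2, omega_pow_3n; simpl fst; simpl snd.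
  real_eq; simpl; ring.
- assert (G := infinite_sum_group3 _ _ S2).
  replace (2 * sqrt 3 * Sh x / (3 * Ch x + 3 * s x)) with (PSeries im_part x)
    by (rewrite e2; real_eq; field; exact hd).
  apply is_series_Reals; apply is_series_Reals in G; revert G; apply is_series_ext; intro n.
  unfold im_part; rewrite O1, O2, omega_pow_3n; simpl fst; simpl snd.
  real_eq; ring.
(* Dropping index 0 makes the blocks of three run over [3n+1, 3n+2, 3n+3], whose negated first
   coordinates are [0, 1, -1]. *)
- assert (S3 : is_series (fun n => - (re_part (S n) * x ^ S n)) (1 - PSeries re_part x)).
  { replace (1 - PSeries re_part x) with (- (PSeries re_part x - 1)) by ring.
    apply (is_series_opp (V := R_NormedModule) (fun n => re_part (S n) * x ^ S n)).
    apply (is_series_incr_1 (fun n => re_part n * x ^ n)).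
    replace (plus _ _) with (PSeries re_part x); [exact S1|].
    assert (E0 : re_part 0 = 1) by (unfold re_part; rewrite sec_tan_0; simpl; ring).
    unfold plus; simpl; rewrite E0; real_eq; ring. }
  assert (G := infinite_sum_group3 _ _ S3).
  replace ((3 * s x - 3 * c x + 3 * Ch x - sqrt 3 * Sh x) / (3 * Ch x + 3 * s x))
    with (1 - PSeries re_part x)
    by (rewrite e1; real_eq; field; exact hd).
  apply is_series_Reals; apply is_series_Reals in G; revert G; apply is_series_ext; intro n.
  replace (S (3 * n)) with (3 * n + 1)%nat by lia.
  replace (S (3 * n + 1)) with (3 * n + 2)%nat by lia.
  replace (S (3 * n + 2)) with (3 * n + 3)%nat by lia.
  unfold re_part; rewrite O1, O2.
  replace (omega_pow (3 * n + 3)) with (omega_pow (3 * S n)) by (f_equal; lia).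
  rewrite omega_pow_3n; simpl fst; real_eq; ring.
Qed.
End EulerSeries.

(** * Combining the permutation series with the trisected series *)

Theorem theorem14 (E : nat -> R)
  (HE : exists r, 0 < r /\ forall x, Rabs x < r ->
          infinite_sum (fun n => E n * x ^ n / INR (fact n)) (1 / cos x + tan x)) :
  exists r, 0 < r /\ forall x, Rabs x < r ->
    exists q a b cv dv : R,
      infinite_sum (fun n => E (3*n)%nat * x ^ (3*n) / INR (fact (3*n))
                            - E (3*n+1)%nat * x ^ (3*n+1) / INR (fact (3*n+1))) q /\
      infinite_sum (fun n => E (3*n+1)%nat * x ^ (3*n+1) / INR (fact (3*n+1))
                            - E (3*n+2)%nat * x ^ (3*n+2) / INR (fact (3*n+2))) a /\
      infinite_sum (fun n => E (3*n+2)%nat * x ^ (3*n+2) / INR (fact (3*n+2))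
                            - E (3*n+3)%nat * x ^ (3*n+3) / INR (fact (3*n+3))) b /\
      infinite_sum (fun n => INR (cnum n) * x ^ n / INR (fact n)) cv /\
      infinite_sum (fun n => INR (dnum n) * x ^ n / INR (fact n)) dv /\
      q <> 0 /\ cv = a / q /\ dv = b / q /\
      3 * cos (x / 2) - sqrt 3 * sinh (sqrt 3 * x / 2) <> 0 /\
      cv = 2 * sqrt 3 * sinh (sqrt 3 * x / 2)
           / (3 * cos (x / 2) - sqrt 3 * sinh (sqrt 3 * x / 2)) /\
      dv = (3 * sin (x / 2) - 3 * cos (x / 2) + 3 * cosh (sqrt 3 * x / 2)
            - sqrt 3 * sinh (sqrt 3 * x / 2))
           / (3 * cos (x / 2) - sqrt 3 * sinh (sqrt 3 * x / 2)).
Proof.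
destruct HE as [r0 [hr0 H0]].
assert (H1 : forall x, Rabs x < r0 ->
  is_series (fun n => E n / INR (fact n) * x ^ n) (1 / cos x + tan x)).
{ intros x hx; assert (H2 := H0 x hx); apply is_series_Reals in H2.
  revert H2; apply is_series_ext; intro n; unfold Rdiv; real_eq; ring. }
assert (HL := filter_and _ _ run_series (euler_series _ r0 hr0 H1)).
apply locally_0_iff in HL; destruct HL as [r [hr HL]].
exists r; split; [exact hr|]; intros x hx.
destruct (HL x hx) as [[Hc [Hd hD]] [hden [Hq [Ha Hb]]]].
apply is_series_Reals in Hc; apply is_series_Reals in Hd.
do 5 eexists; split; [|split; [|split; [|split; [exact Hc|split; [exact Hd|]]]]].
- apply is_series_Reals; apply is_series_Reals in Hq.
  revert Hq; apply is_series_ext; intro n; unfold Rdiv; real_eq; ring.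
- apply is_series_Reals; apply is_series_Reals in Ha.
  revert Ha; apply is_series_ext; intro n; unfold Rdiv; real_eq; ring.
- apply is_series_Reals; apply is_series_Reals in Hb.
  revert Hb; apply is_series_ext; intro n; unfold Rdiv; real_eq; ring.
(* [q], [a] and [b] have the common denominator [3 * Ch x + 3 * s x]; it cancels in [a / q] and
   [b / q], leaving the closed forms of [cv] and [dv]. *)
- split; [|split; [field; split; assumption|split; [field; split; assumption|]]].
  + apply Rmult_integral_contrapositive_currified; [exact hD|].
    apply Rinv_neq_0_compat; exact hden.
  + now repeat split.
Qed.
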